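(* Let $A\in\mathbb{R}^{n\times n}$, let $v\in\mathbb{R}^n$ be nonzero, $\beta=\|v\|$, and let $V_{k+1}$, $V_k$, $H_k$, $h_{k+1,k}$, $v_{k+1}$ be produced by $k$ steps of the Arnoldi process for $A$ and $v$ (as specified in the context). Let $$y_k(t)=V_k u_k(t),\qquad u_k(t)=\exp(-tH_k)(\beta e_1),$$ be the Krylov subspace approximation to $y(t)=\exp(-tA)v$. Then for any $t\geq 0$ the residual $r_k(t)=-Ay_k(t)-y_k'(t)$ is $$r_k(t)=-\beta\, h_{k+1,k}\, \bigl(e_k^T\exp(-tH_k)e_1\bigr)\, v_{k+1},$$ and $$\|r_k(t)\|=\bigl|\beta\, h_{k+1,k}\, e_k^T\exp(-tH_k)e_1\bigr|=\bigl|h_{k+1,k}\,[u_k(t)]_k\bigr|,$$ where $[u_k(t)]_k$ is the last entry of $u_k(t)\in\mathbb{R}^k$.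
   Context: $\|\cdot\|$ is the Euclidean norm. After $k$ steps, the Arnoldi process applied to $A\in\mathbb{R}^{n\times n}$ and $v\in\mathbb{R}^n$ delivers orthonormal vectors $v_1,\dots,v_{k+1}\in\mathbb{R}^n$ with $v_1=v/\|v\|$ and an upper-Hessenberg matrix $\underline{H}_k\in\mathbb{R}^{(k+1)\times k}$ with last row $(0,\dots,0,h_{k+1,k})$. With $V_j=[v_1,\dots,v_j]\in\mathbb{R}^{n\times j}$ and $H_k\in\mathbb{R}^{k\times k}$ denoting $\underline{H}_k$ without its last row, one has $AV_k=V_{k+1}\underline{H}_k$, equivalently $$AV_k=V_kH_k+h_{k+1,k}v_{k+1}e_k^T .$$ Here $e_1=(1,0,\dots,0)^T\in\mathbb{R}^k$ and $e_k=(0,\dots,0,1)^T\in\mathbb{R}^k$. The residual of a differentiable vector function $y_k(t)$ approximating the solution $y(t)=\exp(-tA)v$ of $y'(t)=-Ay(t)$, $y(0)=v$, is defined as $r_k(t)=-Ay_k(t)-y_k'(t)$. *)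

(* Defs.v *)
From HB Require Import structures.
From mathcomp Require Import all_boot all_order all_algebra.
From mathcomp Require Import all_classical all_reals all_analysis.

Set Implicit Arguments.
Unset Strict Implicit.
Unset Printing Implicit Defensive.

Import Order.TTheory GRing.Theory Num.Theory.
Import numFieldNormedType.Exports.

Local Open Scope classical_set_scope.
Local Open Scope ring_scope.

(* The library norm `|x| on matrices is the max norm, hence this definition. *)
Definition enorm (R : realType) (n : nat) (x : 'cV[R]_n) : R :=
  Num.sqrt (\sum_(i < n) x i 0 ^+ 2).

Definition expmx (R : realType) (m : nat) (M : 'M[R]_m) : 'M[R]_m :=
  limn (series (fun j : nat => j`!%:R^-1 *: M ^+ j)).

(* The number of Arnoldi steps is k.+1 throughout, so that it is at least 1.
   V is V_{k+1} and H is the rectangular Hessenberg matrix; indices start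
   at 0. *)

Section ArnoldiBlocks.
Variables (R : realType) (n k : nat).

Definition init_cols (V : 'M[R]_(n, k.+2)) : 'M[R]_(n, k.+1) :=
  colsub (widen_ord (leqnSn k.+1)) V.

Definition last_vec (V : 'M[R]_(n, k.+2)) : 'cV[R]_n := col ord_max V.

Definition square_part (H : 'M[R]_(k.+2, k.+1)) : 'M[R]_k.+1 :=
  rowsub (widen_ord (leqnSn k.+1)) H.

Definition last_entry (H : 'M[R]_(k.+2, k.+1)) : R := H ord_max ord_max.

End ArnoldiBlocks.

(* The Hessenberg condition makes the last row of H equal to
   (0, ..., 0, last_entry H). *)
Record arnoldi (R : realType) (n k : nat) (A : 'M[R]_n) (v : 'cV[R]_n)
    (V : 'M[R]_(n, k.+2)) (H : 'M[R]_(k.+2, k.+1)) : Prop := Arnoldi {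
  arnoldi_orthonormal : V^T *m V = 1%:M ;
  arnoldi_start : col ord0 V = (enorm v)^-1 *: v ;
  arnoldi_hessenberg :
    forall (i : 'I_k.+2) (j : 'I_k.+1), (j.+1 < i)%N -> H i j = 0 ;
  arnoldi_relation : A *m init_cols V = V *m H }.

Definition e_first (R : realType) (k : nat) : 'cV[R]_k.+1 := delta_mx ord0 0.

Definition e_last (R : realType) (k : nat) : 'cV[R]_k.+1 := delta_mx ord_max 0.

Definition krylov_coord (R : realType) (k : nat) (H : 'M[R]_(k.+2, k.+1))
    (beta t : R) : 'cV[R]_k.+1 :=
  expmx ((- t) *: square_part H) *m (beta *: e_first R k).

Definition krylov_approx (R : realType) (n k : nat) (V : 'M[R]_(n, k.+2))
    (H : 'M[R]_(k.+2, k.+1)) (beta t : R) : 'cV[R]_n :=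
  init_cols V *m krylov_coord H beta t.

Definition residual (R : realType) (n : nat) (A : 'M[R]_n)
    (y : R -> 'cV[R]_n) (t : R) : 'cV[R]_n :=
  (- A) *m y t - derive1 y t.

(* Main.v *)
(* Each entry of exp(sM) is a power series in s whose coefficients are dominated
   by those of exp(m |M| s), so termwise differentiation gives
   d/ds exp(sM) = M exp(sM). Hence y_k' = - V_k H_k u_k, while the Arnoldi
   relation gives - A y_k = - V_k H_k u_k - h_{k+1,k} v_{k+1} (e_k^T u_k); the
   first terms cancel in the residual, and |v_{k+1}| = 1 yields its norm. *)

Require Import Defs.
From HB Require Import structures.
From mathcomp Require Import all_boot all_order all_algebra.
From mathcomp Require Import all_classical all_reals all_analysis.

Import Order.TTheory GRing.Theory Num.Theory.
Import numFieldNormedType.Exports.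

Local Open Scope classical_set_scope.
Local Open Scope ring_scope.

(** The factor [n] counts the terms in each entry of the product; the max norm is not
    submultiplicative in general. *)
Lemma ler_mx_norm_mulmx (R : realDomainType) (m n p : nat)
    (A : 'M[R]_(m, n)) (B : 'M[R]_(n, p)) :
  mx_norm (A *m B) <= n%:R * mx_norm A * mx_norm B.
Proof.
have entry_le (q r : nat) (C : 'M[R]_(q, r)) i j : `|C i j| <= mx_norm C.
  by rewrite mx_normrE; exact: (le_bigmax _ (fun ij => `|C ij.1 ij.2|) (i, j)).
have norm_ge0 (q r : nat) (C : 'M[R]_(q, r)) : 0 <= mx_norm C.
  by rewrite mx_normrE; exact: bigmax_ge_id.
rewrite [leLHS]mx_normrE; apply: bigmax_le; first by rewrite !mulr_ge0.
move=> [i j] _ /=; rewrite mxE (le_trans (ler_norm_sum _ _ _))//.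
rewrite (le_trans (ler_sum _ (G := fun=> mx_norm A * mx_norm B) _))//.
  by move=> l _; rewrite normrM ler_pM.
by rewrite sumr_const card_ord -mulrA mulr_natl.
Qed.

Lemma is_derive_mxP (R : realFieldType) (U : normedModType R) (m n : nat)
    (M : U -> 'M[R]_(m, n)) (x v : U) (dM : 'M[R]_(m, n)) :
  is_derive x v M dM <->
  forall i j, is_derive x v (fun y => M y i j) (dM i j).
Proof.
split=> [[dvM DM] i j|dvM].
  apply: DeriveDef; first exact: (derivable_mxP M x v).1.
  by rewrite -DM derive_mx// mxE.
have dM' : derivable M x v by apply/derivable_mxP => i j; case: (dvM i j).
apply: DeriveDef => //; rewrite derive_mx//; apply/matrixP => i j.
by rewrite mxE; case: (dvM i j).
Qed.

(* The library declares the complete and the normed structures on matrices, but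
   not their join, which [normed_cvg] needs. *)
HB.instance Definition _ (R : realType) (m n : nat) :=
  Complete.on 'M[R]_(m, n).

Section MatrixExponential.
Variables (R : realType) (m : nat).
Implicit Types (M N : 'M[R]_m) (x : R).

Lemma ler_norm_expr_mx M n : `|M ^+ n| <= (m%:R * `|M|) ^+ n.
Proof.
elim: n => [|n IHn].
  rewrite !expr0 [leLHS]mx_normrE; apply: bigmax_le => // -[i j] _ /=.
  by rewrite mxE; case: eqP; rewrite ?normr1 ?normr0.
rewrite !exprS (le_trans (ler_mx_norm_mulmx _ _ _ _ _ _))// ler_wpM2l//.
exact: (mulr_ge0 (ler0n _ _) (normr_ge0 M)).
Qed.

(** Absolute convergence, by comparison with the scalar series of exp(m |M|). As [limn] returns a
    default value on divergent sequences, [expmx] gets its meaning from this fact. *)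
Lemma is_cvg_expmx M : cvgn (series (fun n => n`!%:R^-1 *: M ^+ n)).
Proof.
apply: normed_cvg.
apply: series_le_cvg (is_cvg_series_exp_coeff (m%:R * `|M|)) => n //=.
  by rewrite divr_ge0// exprn_ge0// mulr_ge0.
rewrite normrZ ger0_norm ?invr_ge0// /exp_coeff/= mulrC.
by rewrite ler_wpM2r ?invr_ge0 ?ler_norm_expr_mx.
Qed.

(* [exprZn] does not apply: 'M_m is an algebra only when m is a successor. *)
Lemma exprZmx M x n : (x *: M) ^+ n = x ^+ n *: M ^+ n.
Proof.
elim: n => [|n IHn]; first by rewrite !expr0 scale1r.
by rewrite !exprS IHn -[LHS]scalemxAl -scalemxAr scalerA.
Qed.

(** The left factor [N] makes this family of scalar power series closed under formal
    differentiation, which replaces [N] by [N *m M]. *)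
Lemma cvg_pseries_expmx M N x i j :
  pseries (fun n => n`!%:R^-1 * (N *m M ^+ n) i j) x @ \oo
    --> (N *m expmx (x *: M)) i j.
Proof.
pose S := series (fun n => n`!%:R^-1 *: (x *: M) ^+ n).
rewrite [X in X @ _](_ : _ = (fun n => \sum_l N i l * S n l j)).
  rewrite mxE; apply: cvg_big => [|l _]; first exact: add_continuous.
  apply: cvgMl_tmp.
  apply: (@cvg_comp _ _ _ S (fun C : 'M[R]_m => C l j)).
    exact: is_cvg_expmx.
  exact: coord_continuous.
apply/funext => n; rewrite /pseries /series /=.
transitivity ((N *m S n) i j); last by rewrite mxE.
rewrite /S /series /= mulmx_sumr summxE; apply: eq_bigr => l _.
by rewrite exprZmx scalerA -scalemxAr [RHS]mxE mulrAC.
Qed.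

Lemma pseries_diffs_expmx M N i j :
  pseries_diffs (fun n => n`!%:R^-1 * (N *m M ^+ n) i j)
  = (fun n => n`!%:R^-1 * (N *m M *m M ^+ n) i j).
Proof.
apply/funext => n; rewrite /pseries_diffs factS exprS mulmxA mulrA; congr (_ * _).
by rewrite natrM invfM mulrA mulfV ?mul1r// pnatr_eq0.
Qed.

Lemma is_derive_expmx M x :
  is_derive x 1 (fun s => expmx (s *: M)) (M *m expmx (x *: M)).
Proof.
apply/is_derive_mxP => i j.
have cvgS N s := cvgP _ (cvg_pseries_expmx M N s i j).
have limE N s : limn (pseries (fun n => n`!%:R^-1 * (N *m M ^+ n) i j) s)
    = (N *m expmx (s *: M)) i j.
  by apply: cvg_lim => //; exact: cvg_pseries_expmx.
(* Differentiating termwise at [x] requires the series and its first two formal derivatives (the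
   cases N = 1, M, M^2) to converge at some point of larger modulus; |x| + 1 is one. *)
have ltx : `|x| < `| `|x| + 1 |.
  by rewrite [ltRHS]ger0_norm ?ltrDl// addr_ge0.
have := @pseries_snd_diffs R (fun n => n`!%:R^-1 * (1%:M *m M ^+ n) i j)
  (`|x| + 1) x (cvgS _ _).
rewrite !pseries_diffs_expmx => /(_ (cvgS _ _) (cvgS _ _) ltx).
by rewrite limE mul1mx; under eq_fun do rewrite limE mul1mx.
Qed.

End MatrixExponential.

(** Each entry of the product is a linear combination, with constant coefficients, of the entries of
    the middle factor. *)
Lemma is_derive_mulmx_const (R : realFieldType) (U : normedModType R)
    (m n p q : nat) (M : U -> 'M[R]_(n, p)) (x v : U) (dM : 'M[R]_(n, p))
    (A : 'M[R]_(m, n)) (B : 'M[R]_(p, q)) :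
  is_derive x v M dM -> is_derive x v (fun y => A *m M y *m B) (A *m dM *m B).
Proof.
move=> /is_derive_mxP dvM; apply/is_derive_mxP => i j.
have mulE (C : 'M[R]_(n, p)) :
    (A *m C *m B) i j = \sum_l \sum_h (B l j * A i h) * C h l.
  rewrite mxE; apply: eq_bigr => l _; rewrite mxE mulr_suml.
  by apply: eq_bigr => h _; rewrite mulrC mulrA.
have -> : (fun y => (A *m M y *m B) i j)
    = \sum_l \sum_h (B l j * A i h) \*: (fun y => M y h l).
  apply/funext => y; rewrite mulE fct_sumE.
  by under [RHS]eq_bigr do rewrite fct_sumE.
rewrite mulE; apply: is_derive_sum => l; apply: is_derive_sum => h.
Qed.

Lemma enormZ (R : realType) (n : nat) (a : R) (x : 'cV[R]_n) :
  enorm (a *: x) = `|a| * enorm x.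
Proof.
rewrite /enorm -sqrtr_sqr -sqrtrM ?sqr_ge0// mulr_sumr.
by congr Num.sqrt; apply: eq_bigr => i _; rewrite mxE exprMn.
Qed.

Lemma tr_e_last_mulmx (R : realType) (k n : nat) (M : 'M[R]_(k.+1, n)) :
  (e_last R k)^T *m M = row ord_max M.
Proof. by rewrite trmx_delta -rowE. Qed.

Section Arnoldi.
Variables (R : realType) (n k : nat) (A : 'M[R]_n) (v : 'cV[R]_n).
Variables (V : 'M[R]_(n, k.+2)) (H : 'M[R]_(k.+2, k.+1)).
Hypothesis AVH : arnoldi A v V H.

Lemma enorm_last_vec : enorm (last_vec V) = 1.
Proof.
have /matrixP/(_ ord_max ord_max) := arnoldi_orthonormal AVH.
rewrite !mxE eqxx mulr1n => VV; rewrite /enorm -[RHS]sqrtr1 -VV.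
by congr Num.sqrt; apply: eq_bigr => i _; rewrite !mxE expr2.
Qed.

Lemma arnoldi_split :
  A *m init_cols V = init_cols V *m square_part H
                     + last_entry H *: (last_vec V *m (e_last R k)^T).
Proof.
rewrite (arnoldi_relation AVH); apply/matrixP => i j.
(* This splits off the last column of [V] against the last row of [H], where the Hessenberg
   condition leaves only the final entry. *)
rewrite !mxE big_ord_recr/=; congr (_ + _).
  by apply: eq_bigr => l _; rewrite !mxE.
rewrite big_ord1 !mxE eqxx andbT.
have [->|jmax] := eqVneq j ord_max; first by rewrite mulr1 mulrC.
rewrite (arnoldi_hessenberg AVH) ?mulr0//.
by rewrite ltnS ltn_neqAle -ltnS ltn_ord andbT.
Qed.

Lemma is_derive_krylov_approx (beta t : R) :
  is_derive t 1 (krylov_approx V H beta)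
    (- (init_cols V *m square_part H *m krylov_coord H beta t)).
Proof.
rewrite /krylov_approx /krylov_coord.
(* The sign moves from [t] to the matrix, so that the derivative of exp(sM) applies with M = -H_k
   and s = t. *)
under eq_fun do rewrite mulmxA scaleNr -scalerN.
apply: is_derive_eq.
  by apply: is_derive_mulmx_const; exact: is_derive_expmx.
by rewrite scaleNr scalerN !(mulmxN, mulNmx) !mulmxA.
Qed.

Lemma residual_krylov_approx (beta t : R) :
  residual A (krylov_approx V H beta) t
  = - (last_entry H * krylov_coord H beta t ord_max 0) *: last_vec V.
Proof.
rewrite /residual derive1E.
rewrite (derive_val (is_derive := is_derive_krylov_approx _ _)).
rewrite opprK /krylov_approx mulNmx mulmxA arnoldi_split mulmxDl opprD addrAC.
rewrite addNr add0r -scalemxAl scaleNr -scalerA -mulmxA tr_e_last_mulmx.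
(* The row e_k^T u is a 1 by 1 matrix, still to be turned into a scalar. *)
congr (- (_ *: _)); move: (krylov_coord H beta t) => u.
by apply/matrixP => i j; rewrite !mxE big_ord1 !mxE ord1 mulrC.
Qed.

End Arnoldi.

Lemma krylov_coordE (R : realType) (k : nat) (H : 'M[R]_(k.+2, k.+1))
    (beta t : R) :
  krylov_coord H beta t ord_max 0
  = beta * ((e_last R k)^T *m expmx ((- t) *: square_part H)
              *m e_first R k) 0 0.
Proof.
by rewrite /krylov_coord -scalemxAr mxE -mulmxA tr_e_last_mulmx [in RHS]mxE.
Qed.

(** Derivability is part of the conclusion because [derive1] is total: it ensures that [r t]
    involves a genuine derivative. *)
Theorem lemma2p1 (R : realType) (n k : nat) (A : 'M[R]_n) (v : 'cV[R]_n)
    (V : 'M[R]_(n, k.+2)) (H : 'M[R]_(k.+2, k.+1)) (t : R) :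
  v != 0 ->
  arnoldi A v V H ->
  0 <= t ->
  let beta := enorm v in
  let h := last_entry H in
  let u := krylov_coord H beta in
  let y := krylov_approx V H beta in
  let r := residual A y in
  let c := ((e_last R k)^T *m expmx ((- t) *: square_part H)
              *m e_first R k) 0 0 in
  [/\ derivable y t 1,
      r t = - (beta * h * c) *: last_vec V,
      enorm (r t) = `|beta * h * c| &
      `|beta * h * c| = `|h * u t ord_max 0| ].
Proof.
move=> _ AVH _ beta h u y r c.
have hu : beta * h * c = h * u t ord_max 0.
  by rewrite /u krylov_coordE mulrA [h * beta]mulrC.
have rE : r t = - (beta * h * c) *: last_vec V.
  by rewrite hu; exact: (residual_krylov_approx _ _ _ _ _ _ _ AVH).
split=> //; last by rewrite hu.
- by case: (is_derive_krylov_approx _ _ _ V H beta t).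
- by rewrite rE enormZ normrN (enorm_last_vec _ _ _ _ _ _ _ AVH) mulr1.
Qed.
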